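(* The only axisymmetric critical points of $E_\gamma$ for an interval of $\gamma$-values are the single cap and the symmetric double cap. That is, let $u$ be an axisymmetric pattern with $n\ge1$ interfaces $-1<z_1<\dots<z_n<1$ (and mass $m\in(-1,1)$). Then there is a nondegenerate interval $I\subset(0,\infty)$ such that $u$ is a critical point of $E_\gamma$ for every $\gamma\in I$ if and only if either $n=1$ (single cap), or $n=2$ and $z_1=-z_2$ (symmetric double cap).
   Context: For $u\in BV(\mathbb{S}^2;\{\pm1\})$ with $\frac1{4\pi}\int_{\mathbb{S}^2}u\,d\mathcal{H}^2=m$ and $\gamma>0$, the energy is $$E_\gamma(u)=\frac12\int_{\mathbb{S}^2}|\nabla u|+\gamma\int_{\mathbb{S}^2}|\nabla v|^2\,d\mathcal{H}^2,$$ where $\int_{\mathbb{S}^2}|\nabla u|$ is the total variation of $u$, $v$ solves $-\Delta v=u-m$ on $\mathbb{S}^2$ ($\Delta$ is the Laplace--Beltrami operator of the unit sphere, and $v$ is unique up to an additive constant) and $\nabla$ is the gradient on $\mathbb{S}^2$. Functions on $\mathbb{S}^2$ depending only on the polar angle $\phi$ are regarded as functions of $z=\cos\phi\in[-1,1]$. An axisymmetric pattern with $n$ interfaces at $-1=z_0<z_1<\dots<z_n<z_{n+1}=1$ is the function $u$ with $u=(-1)^{k+1}$ on $[z_k,z_{k+1})$ for $k=0,\dots,n$; its mass is $m=\frac1{4\pi}\int_{\mathbb{S}^2}u\,d\mathcal{H}^2=\frac12\sum_{k=1}^{n+1}(-1)^k(z_k-z_{k-1})$. For such $u$, $v$ is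 also a function of $z$. Such a pattern is a critical point of $E_\gamma$ if it satisfies the Euler--Lagrange equation: there is a constant $\lambda$ (which may depend on $u$ and $\gamma$) with $\kappa_g(z_k)+4\gamma v(z_k)=\lambda$ for all $k=1,\dots,n$, where $\kappa_g(z_k)$ is the signed geodesic curvature of the circle $\{z=z_k\}$ with respect to the normal pointing out of $\{u=1\}$, i.e. $\kappa_g(z_k)=(-1)^{k+1}z_k/\sqrt{1-z_k^2}$. *)

(* Defs.v *)
From Stdlib Require Import Reals.
From Coquelicot Require Import Coquelicot.
Open Scope R_scope.

Definition R3 : NormedModule R_AbsRing :=
  prod_NormedModule R_AbsRing
    (prod_NormedModule R_AbsRing R_NormedModule R_NormedModule) R_NormedModule.

Definition pt (x1 x2 x3 : R) : R3 := ((x1, x2), x3).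

Definition height (x : R3) : R := snd x.

Definition dot (x y : R3) : R :=
  fst (fst x) * fst (fst y) + snd (fst x) * snd (fst y) + snd x * snd y.

Definition S2 (x : R3) : Prop := dot x x = 1.

(** Integral over the unit sphere with respect to the surface measure H^2.  By
    Archimedes' theorem the cylindrical parametrisation by
    (z, theta) in [-1,1] x [0, 2 PI] has Jacobian 1. *)
Definition sphere_pt (z theta : R) : R3 :=
  pt (sqrt (1 - z ^ 2) * cos theta) (sqrt (1 - z ^ 2) * sin theta) z.

Definition S2_integral (f : R3 -> R) : R :=
  RInt (fun theta => RInt (fun z => f (sphere_pt z theta)) (-1) 1) 0 (2 * PI).

Definition mass (u : R3 -> R) : R := / (4 * PI) * S2_integral u.

(** [S2_C1 f G]: the restriction of [f] to the sphere is of class C^1 with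
    Riemannian gradient [G].  Only values at points of the sphere matter: the
    difference quotients are taken along the sphere, and tangency makes [G x]
    unique. *)
Definition S2_C1 (f : R3 -> R) (G : R3 -> R3) : Prop :=
  forall x : R3, S2 x ->
    dot (G x) x = 0 /\
    @filterdiff R_AbsRing R3 R_NormedModule
      f (within S2 (locally x)) (fun h => dot (G x) h) /\
    filterlim G (within S2 (locally x)) (locally (G x)).

(** [v] solves [- Delta v = f] on the sphere, Delta being the Laplace-Beltrami
    operator.  Since [f] will be discontinuous the equation is understood weakly,
    through the Green formula
      int grad v . grad phi = int f phi   for all test functions phi.
    For bounded [f] the weak solutions are of class C^1 by elliptic regularity;
    taking [v] in C^1 selects the representative with pointwise values. *)
Definition S2_poisson (v f : R3 -> R) : Prop :=
  exists Gv : R3 -> R3, S2_C1 v Gv /\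
    forall (phi : R3 -> R) (Gphi : R3 -> R3), S2_C1 phi Gphi ->
      S2_integral (fun x => dot (Gv x) (Gphi x)) =
      S2_integral (fun x => f x * phi x).

(** Only [z 0], ..., [z (n + 1)] are used. *)
Definition interfaces (n : nat) (z : nat -> R) : Prop :=
  z 0%nat = -1 /\ z (n + 1)%nat = 1 /\
  forall k : nat, (k <= n)%nat -> z k < z (k + 1)%nat.

(** The value of [u] at the north pole, which lies in no [z_k, z_{k+1}), is left
    unspecified. *)
Definition axisymmetric_pattern (n : nat) (z : nat -> R) (u : R3 -> R) : Prop :=
  interfaces n z /\
  forall (k : nat) (x : R3), (k <= n)%nat -> S2 x ->
    z k <= height x < z (k + 1)%nat -> u x = (-1) ^ (k + 1).

(** Geodesic curvature of the circle at height [z k], with respect to the normal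
    pointing out of {u = 1}. *)
Definition geodesic_curvature (z : nat -> R) (k : nat) : R :=
  (-1) ^ (k + 1) * z k / sqrt (1 - z k ^ 2).

(** Euler-Lagrange equation of E_gamma, required at every point of every
    interface circle.  [v] is unique up to an additive constant, which is
    absorbed by [lambda]. *)
Definition critical_point (gamma : R) (n : nat) (z : nat -> R) (u : R3 -> R)
    : Prop :=
  exists v : R3 -> R,
    S2_poisson v (fun x => u x - mass u) /\
    exists lambda : R,
      forall (k : nat) (x : R3), (1 <= k <= n)%nat -> S2 x -> height x = z k ->
        geodesic_curvature z k + 4 * gamma * v x = lambda.

Definition nondegenerate_interval (I : R -> Prop) : Prop :=
  (forall a b t : R, I a -> I b -> a <= t <= b -> I t) /\
  exists a b : R, I a /\ I b /\ a < b.

(* Main.v *)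
Require Import Defs.
From Stdlib Require Import Reals Lra Lia.
From Coquelicot Require Import Coquelicot.
Open Scope R_scope.

(** If a pattern is critical for two values [a < b] of gamma, the potentials
    [v] for the two values solve the same Poisson equation, so they differ by a
    constant ([S2_poisson_unique]: the difference is weakly harmonic, and testing
    with it gives zero Dirichlet energy). The two Euler-Lagrange equations are
    then affine in gamma with the same data, so the curvature alone is the same
    on all interfaces ([critical_interval_curvature]). The signed curvature is
    [(-1)^(k+1)] times an injective odd function of [z_k]; hence
    [z_k = (-1)^(k+1) z_1], which for an increasing sequence allows only
    [n = 1], or [n = 2] with [z_1 = - z_2] ([equal_curvature_cap_or_band]).

    Conversely, in these two cases the Poisson equation has an explicit zonal
    solution [v(x) = V(x_3)], whose derivative is found by integrating
    [- ((1 - z^2) V')' = u - m] once. Green's formula for it is checked on every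
    meridian by a piecewise application of the fundamental theorem of calculus
    ([S2_poisson_potential], [is_RInt_flux_step]). For one interface the
    Euler-Lagrange equation only defines lambda. For the symmetric double cap [V']
    is odd, so [V] is even, and both the potential and the curvature take equal
    values on the two circles; every gamma is admissible. *)

(** * Real functions of one variable *)

Lemma locally_open_interval (a b x : R) : a < x < b ->
  locally x (fun y => a < y < b).
Proof.
  intro Hx. apply (open_and (fun y : R => a < y) (fun y => y < b));
    [apply open_gt | apply open_lt | exact Hx].
Qed.

Definition clamp (a b z : R) : R := Rmax a (Rmin b z).

Lemma clamp_bounds a b z : a <= b -> a <= clamp a b z <= b.
Proof.
  intro H; unfold clamp; split; [apply Rmax_l|].
  apply Rmax_lub; [exact H | apply Rmin_l].
Qed.

Lemma clamp_id a b z : a <= z <= b -> clamp a b z = z.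
Proof. intros [Ha Hb]; unfold clamp; rewrite Rmin_right, Rmax_right; lra. Qed.

Lemma continuous_Rmin_l a z : continuous (Rmin a) z.
Proof.
  apply continuous_ext with (fun y => (a + y - Rabs (a - y)) * / 2).
  { intro y; unfold Rmin, Rabs.
    destruct (Rle_dec a y), (Rcase_abs (a - y)); lra. }
  apply (continuous_mult (K := R_AbsRing)); [|apply continuous_const].
  apply (continuous_minus (V := R_NormedModule)).
  - apply (continuous_plus (V := R_NormedModule));
      [apply continuous_const | apply continuous_id].
  - apply continuous_Rabs_comp.
    apply (continuous_minus (V := R_NormedModule));
      [apply continuous_const | apply continuous_id].
Qed.

Lemma continuous_Rmax_l a z : continuous (Rmax a) z.
Proof.
  apply continuous_ext with (fun y => - Rmin (- a) (- y)).
  { intro y. rewrite <- Ropp_Rmax. lra. }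
  apply (continuous_opp (V := R_NormedModule)).
  apply (continuous_comp Ropp (Rmin (- a))).
  - apply (continuous_opp (V := R_NormedModule)), continuous_id.
  - apply continuous_Rmin_l.
Qed.

Lemma continuous_clamp a b z : continuous (clamp a b) z.
Proof.
  apply (continuous_comp (Rmin b) (Rmax a));
    [apply continuous_Rmin_l | apply continuous_Rmax_l].
Qed.

Lemma continuous_Rdiv (f g : R -> R) x : continuous f x -> continuous g x ->
  g x <> 0 -> continuous (fun y => f y / g y) x.
Proof.
  intros Hf Hg H0. apply (continuous_mult (K := R_AbsRing)); [exact Hf|].
  now apply continuous_Rinv_comp.
Qed.

Lemma is_RInt_continuous (f : R -> R) a b : (forall x, continuous f x) ->
  is_RInt f a b (RInt f a b).
Proof.
  intro Hf. apply (RInt_correct (V := R_CompleteNormedModule)).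
  now apply (ex_RInt_continuous (V := R_CompleteNormedModule)).
Qed.

Lemma is_derive_RInt_continuous (f : R -> R) a z : (forall x, continuous f x) ->
  is_derive (fun y => RInt f a y) z (f z).
Proof.
  intro Hf. apply (is_derive_RInt (V := R_NormedModule) f (fun y => RInt f a y) a z);
    [|apply Hf].
  exists (mkposreal 1 Rlt_0_1); intros y _. now apply is_RInt_continuous.
Qed.

Lemma is_RInt_step (f : R -> R) a b c : a <= b ->
  (forall y, a < y < b -> f y = c) -> is_RInt f a b ((b - a) * c).
Proof.
  intros Hab Hf. apply is_RInt_ext with (fun _ => c).
  - rewrite Rmin_left, Rmax_right by exact Hab. intros y Hy. now rewrite Hf.
  - apply (is_RInt_const (V := R_NormedModule)).
Qed.

Lemma RInt_odd (h : R -> R) a : (forall z, continuous h z) ->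
  (forall z, h (- z) = - h z) -> RInt h 0 (- a) = RInt h 0 a.
Proof.
  intros Ch Hodd. symmetry. apply is_RInt_unique.
  apply is_RInt_ext with (fun y => opp (h (- y))).
  - intros y _. unfold opp; simpl. rewrite Hodd. apply Ropp_involutive.
  - apply (is_RInt_comp_opp (V := R_NormedModule)). rewrite Ropp_0.
    now apply is_RInt_continuous.
Qed.

(** The primitive of a nonnegative function is monotone; vanishing at both
    ends, it is constant, so its derivative vanishes in the open interval. The
    endpoints follow by continuity. *)
Lemma RInt_eq_0_continuous (g : R -> R) (a b : R) : a < b ->
  (forall x, continuous g x) -> (forall x, 0 <= g x) -> RInt g a b = 0 ->
  forall x, a <= x <= b -> g x = 0.
Proof.
  intros Hab Hc Hp H0.
  assert (Hex : forall c d, is_RInt g c d (RInt g c d))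
    by (intros c d; now apply is_RInt_continuous).
  assert (HF : forall y, is_derive (fun y => RInt g a y) y (g y))
    by (intro y; now apply is_derive_RInt_continuous).
  assert (Hmon : forall c d, c <= d -> 0 <= RInt g c d).
  { intros c d Hcd. apply RInt_ge_0; auto. now exists (RInt g c d). }
  assert (Hz : forall y, a <= y <= b -> RInt g a y = 0).
  { intros y Hy.
    pose proof (RInt_Chasles (V := R_CompleteNormedModule) g a y b
      (ex_intro _ _ (Hex _ _)) (ex_intro _ _ (Hex _ _))) as E.
    unfold plus in E; simpl in E. rewrite H0 in E.
    generalize (Hmon a y (proj1 Hy)) (Hmon y b (proj2 Hy)). lra. }
  assert (Hin : forall y, a < y < b -> g y = 0).
  { intros y Hy. rewrite <- (is_derive_unique _ _ _ (HF y)).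
    apply is_derive_unique. apply (is_derive_ext_loc (fun _ => 0)).
    - generalize (locally_open_interval _ _ _ Hy). apply filter_imp.
      intros w Hw. symmetry; apply Hz; lra.
    - apply (is_derive_const (V := R_NormedModule)). }
  intros x Hx.
  destruct (Req_dec (g x) 0) as [|Hne]; [assumption|].
  assert (Hgx : 0 < g x) by (generalize (Hp x); lra).
  assert (locally x (fun y => 0 < g y)) as [e He].
  { apply (Hc x (fun v => 0 < v)). now apply open_gt. }
  (* Positivity persists near [x], so a step from [x] towards the midpoint
     reaches a point of the open interval where it still holds. *)
  pose (y := if Rle_dec x ((a + b) / 2) then x + Rmin (e / 2) ((b - a) / 4)
             else x - Rmin (e / 2) ((b - a) / 4)).
  generalize (cond_pos e); intro He0.
  assert (Hm : 0 < Rmin (e / 2) ((b - a) / 4)) by (apply Rmin_pos; lra).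
  generalize (Rmin_l (e / 2) ((b - a) / 4)) (Rmin_r (e / 2) ((b - a) / 4)); intros.
  assert (Hy : a < y < b) by (unfold y; destruct Rle_dec; lra).
  assert (Hy' : Rabs (y - x) < e) by (unfold y; destruct Rle_dec; apply Rabs_def1; lra).
  specialize (He y Hy'). rewrite (Hin y Hy) in He. lra.
Qed.

(** Continuity on the compact rectangle is uniform, so the slices converge
    uniformly and their integrals converge. Clamping the integration variable
    makes the convergence uniform on the whole line, which is the topology of
    the function space in [filterlim_RInt]. *)
Lemma continuous_RInt_param (g : R -> R -> R) (a b t : R) : a <= b ->
  (forall s p, continuity_2d_pt g s p) ->
  continuous (fun p => RInt (fun s => g s p) a b) t.
Proof.
  intros Hab Hg.
  assert (Hex : forall p h, (forall s, a < s < b -> h s = g s p) ->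
            is_RInt h a b (RInt (fun s => g s p) a b)).
  { intros p h Hh. apply is_RInt_ext with (fun s => g s p).
    { rewrite Rmin_left, Rmax_right by exact Hab. intros s Hs. now symmetry; apply Hh. }
    apply is_RInt_continuous. intro s.
    apply (continuous_comp_2 (fun s => s) (fun _ => p) g);
      [apply continuous_id | apply continuous_const |].
    now apply continuity_2d_pt_filterlim, Hg. }
  assert (Hcl : forall p,
            is_RInt (fun s => g (clamp a b s) p) a b (RInt (fun s => g s p) a b)).
  { intro p. apply Hex. intros s Hs. rewrite clamp_id; [reflexivity | lra]. }
  destruct (filterlim_RInt (V := R_CompleteNormedModule)
              (fun p s => g (clamp a b s) p) a b (locally t) _
              (fun s => g (clamp a b s) t) _ Hcl) as (I & HI & HI').
  - intros P [e He].
    destruct (uniform_continuity_2d_1d g a b t (fun x _ => Hg x t) e) as [d Hd].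
    exists d. intros p Hp. apply He. intro s.
    change (Rabs (g (clamp a b s) p - g (clamp a b s) t) < e).
    change (Rabs (p - t) < d) in Hp. apply Rabs_def2 in Hp.
    generalize (cond_pos d); intro Hd0.
    apply Hd; try (apply clamp_bounds; exact Hab); try lra.
    rewrite Rminus_diag, Rabs_R0; lra.
  - unfold continuous.
    replace (RInt (fun s => g s t) a b) with I; [exact HI|].
    exact (eq_trans (eq_sym (is_RInt_unique _ _ _ _ HI')) (is_RInt_unique _ _ _ _ (Hcl t))).
Qed.

(** * Differentials along filters and in coordinates *)

Lemma continuous_pair {T U V : UniformSpace} (f : T -> U) (g : T -> V) (x : T) :
  continuous f x -> continuous g x ->
  continuous (fun t => (f t, g t) : prod_UniformSpace U V) x.
Proof.
  intros Hf Hg P [e He].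
  destruct (Hf (fun y => ball (f x) e y)) as [e1 H1]; [now exists e|].
  destruct (Hg (fun y => ball (g x) e y)) as [e2 H2]; [now exists e|].
  assert (Hm : 0 < Rmin e1 e2) by (apply Rmin_pos; apply cond_pos).
  exists (mkposreal _ Hm); intros y Hy; apply He; split.
  - apply H1. eapply ball_le, Hy. apply Rmin_l.
  - apply H2. eapply ball_le, Hy. apply Rmin_r.
Qed.

Lemma filterdiff_pair {U V W : NormedModule R_AbsRing}
    (f : U -> V) (g : U -> W) (x : U) (lf : U -> V) (lg : U -> W) :
  filterdiff f (locally x) lf -> filterdiff g (locally x) lg ->
  filterdiff (fun t => (f t, g t) : prod_NormedModule R_AbsRing V W) (locally x)
    (fun h => (lf h, lg h) : prod_NormedModule R_AbsRing V W).
Proof.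
  intros Hf Hg.
  apply (filterdiff_comp_2 (W := prod_NormedModule R_AbsRing V W)
           f g (fun a b => (a, b)) lf lg (fun a b => (a, b)) Hf Hg).
  apply filterdiff_linear.
  apply is_linear_prod; [apply is_linear_fst | apply is_linear_snd].
Qed.

(** Restricting the filter of approach keeps a differential. The filters must
    have the same limit because [filterdiff] speaks of the expansion at the
    limits of its filter. *)
Lemma filterdiff_filter_le (f l : R3 -> R) (F G : (R3 -> Prop) -> Prop) (x : R3) :
  ProperFilter F -> filter_le F G -> is_filter_lim F x -> is_filter_lim G x ->
  @filterdiff R_AbsRing R3 R_NormedModule f G l ->
  @filterdiff R_AbsRing R3 R_NormedModule f F l.
Proof.
  intros HF Hle HFx HGx [Hl Hd]. split; [exact Hl|].
  intros y Hy.
  assert (y = x) as -> by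
    exact (is_filter_lim_unique (K := R_AbsRing) (V := R3) y x Hy HFx).
  intro eps. apply Hle. now apply Hd.
Qed.

Lemma continuous_dot {T : UniformSpace} (F G : T -> R3) (x : T) :
  continuous F x -> continuous G x -> continuous (fun t => dot (F t) (G t)) x.
Proof.
  intros HF HG. unfold dot.
  assert (A : forall H : T -> R3, continuous H x ->
     continuous (fun t => fst (fst (H t))) x /\
     continuous (fun t => snd (fst (H t))) x /\ continuous (fun t => snd (H t)) x).
  { intros H HH.
    assert (H12 : continuous (fun t => fst (H t)) x).
    { apply (continuous_comp H fst); [exact HH|].
      destruct (H x). apply continuous_fst. }
    repeat split.
    - apply (continuous_comp (fun t => fst (H t)) fst); [exact H12|].
      destruct (fst (H x)). apply continuous_fst.
    - apply (continuous_comp (fun t => fst (H t)) snd); [exact H12|].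
      destruct (fst (H x)). apply continuous_snd.
    - apply (continuous_comp H snd); [exact HH|].
      destruct (H x). apply continuous_snd. }
  destruct (A F HF) as (F1 & F2 & F3), (A G HG) as (G1 & G2 & G3).
  repeat apply (continuous_plus (V := R_NormedModule));
    now apply (continuous_mult (K := R_AbsRing)).
Qed.

Lemma dot_minus_l (a b c : R3) : dot (minus a b) c = dot a c - dot b c.
Proof.
  destruct a as [[a1 a2] a3], b as [[b1 b2] b3].
  unfold dot, minus, plus, opp; simpl. unfold plus, opp; simpl. ring.
Qed.

Lemma dot_self_eq_0 (a : R3) : dot a a = 0 -> snd a = 0.
Proof. unfold dot; intro H; nra. Qed.

Lemma filterdiff_dot_self (x : R3) :
  @filterdiff R_AbsRing R3 R_NormedModule (fun y => dot y y) (locally x)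
    (fun h => 2 * dot h x).
Proof.
  assert (L1 : @is_linear R_AbsRing R3 R_NormedModule (fun y => fst (fst y))).
  { apply (is_linear_comp (K := R_AbsRing) (U := R3)
      (V := prod_NormedModule R_AbsRing R_NormedModule R_NormedModule)
      (W := R_NormedModule) fst fst); apply is_linear_fst. }
  assert (L2 : @is_linear R_AbsRing R3 R_NormedModule (fun y => snd (fst y))).
  { apply (is_linear_comp (K := R_AbsRing) (U := R3)
      (V := prod_NormedModule R_AbsRing R_NormedModule R_NormedModule)
      (W := R_NormedModule) fst snd); [apply is_linear_fst | apply is_linear_snd]. }
  assert (L3 : @is_linear R_AbsRing R3 R_NormedModule (fun y => snd y))
    by apply is_linear_snd.
  assert (Hsq : forall p : R3 -> R, @is_linear R_AbsRing R3 R_NormedModule p ->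
     @filterdiff R_AbsRing R3 R_NormedModule (fun y => p y * p y) (locally x)
       (fun h => p h * p x + p x * p h)).
  { intros p Hp.
    apply (filterdiff_mult_fct (K := R_AbsRing) (U := R3) p p x p p Rmult_comm);
      apply filterdiff_linear, Hp. }
  refine (filterdiff_ext_lin (K := R_AbsRing) (U := R3) (V := R_NormedModule) _ _ _
    (filterdiff_plus_fct (K := R_AbsRing) (U := R3) (V := R_NormedModule) _ _ _ _
      (filterdiff_plus_fct (K := R_AbsRing) (U := R3) (V := R_NormedModule) _ _ _ _
        (Hsq _ L1) (Hsq _ L2)) (Hsq _ L3)) _).
  intro h. unfold dot, plus; simpl. ring.
Qed.

(** * Functions of class C1 on the sphere *)

Lemma sphere_pt_S2 z theta : -1 <= z <= 1 -> S2 (sphere_pt z theta).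
Proof.
  intros [H1 H2]; unfold S2, dot, sphere_pt, pt; cbn [fst snd].
  generalize (sin2_cos2 theta); unfold Rsqr; intro Hsc.
  assert (Hs : sqrt (1 - z ^ 2) * sqrt (1 - z ^ 2) = 1 - z ^ 2)
    by (apply sqrt_sqrt; nra).
  transitivity (sqrt (1 - z ^ 2) * sqrt (1 - z ^ 2)
                * (sin theta * sin theta + cos theta * cos theta) + z * z).
  { ring. }
  rewrite Hs, Hsc; ring.
Qed.

Lemma within_S2_proper x : S2 x -> ProperFilter (within S2 (locally x)).
Proof.
  intro Hx; split.
  - intros P HP. exists x. now apply (locally_singleton _ _ HP).
  - apply within_filter, locally_filter.
Qed.

Lemma S2_C1_continuous f G x : S2_C1 f G -> S2 x ->
  filterlim f (within S2 (locally x)) (locally (f x)).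
Proof.
  intros HC Hx. destruct (HC x Hx) as (_ & Hd & _).
  apply (filterdiff_continuous_aux (K := R_AbsRing) (U := R3) (V := R_NormedModule)
           (F := within S2 (locally x))).
  - now exists (fun h => dot (G x) h).
  - intros P HP. unfold within. apply (filter_imp P); [auto | exact HP].
Qed.

Lemma S2_C1_minus f g F G : S2_C1 f F -> S2_C1 g G ->
  S2_C1 (fun x => f x - g x) (fun x => minus (F x) (G x)).
Proof.
  intros Hf Hg x Hx.
  destruct (Hf x Hx) as (Tf & Df & Cf), (Hg x Hx) as (Tg & Dg & Cg).
  pose proof (within_S2_proper x Hx) as PF.
  split; [rewrite dot_minus_l, Tf, Tg; ring|]. split.
  - refine (filterdiff_ext_lin (K := R_AbsRing) (U := R3) (V := R_NormedModule) _ _ _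
      (filterdiff_minus_fct (K := R_AbsRing) (U := R3) (V := R_NormedModule) f g _ _ Df Dg) _).
    intro h. now rewrite dot_minus_l.
  - refine (filterlim_comp_2 F (fun y => opp (G y)) plus Cf _
      (filterlim_plus (V := R3) (F x) (opp (G x)))).
    exact (filterlim_comp _ _ _ G opp _ _ _ Cg (filterlim_opp (V := R3) (G x))).
Qed.

Lemma filterdiff_sphere_pt z theta : -1 < z < 1 ->
  @filterdiff R_AbsRing R_NormedModule R3 (fun y => sphere_pt y theta) (locally z)
    (fun h => pt (h * (- z / sqrt (1 - z ^ 2) * cos theta))
                 (h * (- z / sqrt (1 - z ^ 2) * sin theta)) h).
Proof.
  intro Hz. assert (Hpos : 0 < 1 - z ^ 2) by nra.
  assert (Hsq : 0 < sqrt (1 - z ^ 2)) by now apply sqrt_lt_R0.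
  assert (Hs : forall c, is_derive (fun y => sqrt (1 - y ^ 2) * c) z
                 (- z / sqrt (1 - z ^ 2) * c)).
  { intro c. auto_derive; [lra|].
    replace (1 + - (z * (z * 1))) with (1 - z ^ 2) by ring. field. lra. }
  unfold sphere_pt, pt.
  apply (filterdiff_pair (V := prod_NormedModule R_AbsRing R_NormedModule R_NormedModule)
     (W := R_NormedModule)
     (fun y => (sqrt (1 - y ^ 2) * cos theta, sqrt (1 - y ^ 2) * sin theta))
     (fun y => y)).
  - apply (filterdiff_pair (V := R_NormedModule) (W := R_NormedModule)
     (fun y => sqrt (1 - y ^ 2) * cos theta)
     (fun y => sqrt (1 - y ^ 2) * sin theta)); apply Hs.
  - apply filterdiff_id.
Qed.

(** Along a meridian [x' = e3 - (z / (1 - z^2)) (x - z e3)]. Since the gradient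
    is tangent, only its third component survives, and it gets the factor
    [1 + z^2 / (1 - z^2) = 1 / (1 - z^2)]. *)
Lemma is_derive_meridian f G z theta : S2_C1 f G -> -1 < z < 1 ->
  is_derive (fun y => f (sphere_pt y theta)) z
    (snd (G (sphere_pt z theta)) / (1 - z ^ 2)).
Proof.
  intros HC Hz.
  set (x := sphere_pt z theta).
  assert (Hx : S2 x) by (apply sphere_pt_S2; lra).
  destruct (HC x Hx) as (Htan & Hd & _).
  pose proof (filterdiff_sphere_pt z theta Hz) as Hg.
  assert (Hcont : filterlim (fun y => sphere_pt y theta) (locally z) (locally x)).
  { apply (filterdiff_continuous_aux (K := R_AbsRing) (U := R_NormedModule) (V := R3)
             (fun y => sphere_pt y theta));
      [eexists; exact Hg | intros P HP; exact HP]. }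
  assert (Hd' : @filterdiff R_AbsRing R3 R_NormedModule f
     (filtermap (fun y => sphere_pt y theta) (locally z)) (fun h => dot (G x) h)).
  { apply (filterdiff_filter_le f _ _ (within S2 (locally x)) x);
      [| |exact Hcont| |exact Hd].
    - apply filtermap_proper_filter, locally_filter.
    - intros P HP. unfold filtermap, within in *.
      generalize (filter_and _ _ (locally_open_interval _ _ _ Hz) (Hcont _ HP)).
      apply filter_imp.
      intros y [Hy Hy']. apply Hy', sphere_pt_S2. lra.
    - intros P HP. unfold within. apply (filter_imp P); [auto | exact HP]. }
  refine (filterdiff_ext_lin _ _ _ (filterdiff_comp (K := R_AbsRing)
    (U := R_NormedModule) (V := R3) (W := R_NormedModule) _ f _ _ Hg Hd') _).
  intro h.
  change (dot (G x) (pt (h * (- z / sqrt (1 - z ^ 2) * cos theta))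
                 (h * (- z / sqrt (1 - z ^ 2) * sin theta)) h)
          = h * (snd (G x) / (1 - z ^ 2))).
  assert (Hpos : 0 < 1 - z ^ 2) by nra.
  assert (Hsq : 0 < sqrt (1 - z ^ 2)) by now apply sqrt_lt_R0.
  assert (Hss : sqrt (1 - z ^ 2) * sqrt (1 - z ^ 2) = 1 - z ^ 2) by (apply sqrt_sqrt; lra).
  unfold x, dot, sphere_pt, pt in *; cbn [fst snd] in *.
  set (s := sqrt (1 - z ^ 2)) in *.
  set (g := G (s * cos theta, s * sin theta, z)) in *.
  assert (E : fst (fst g) * cos theta + snd (fst g) * sin theta = - snd g * z / s).
  { apply (Rmult_eq_reg_r s); [|lra]. field_simplify; [|lra]. lra. }
  transitivity (h * (- z / s * (fst (fst g) * cos theta + snd (fst g) * sin theta) + snd g)).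
  { ring. }
  rewrite E.
  replace (1 - z^2) with (s * s).
  transitivity (h * (snd g * ((s * s + z ^ 2) / (s * s)))).
  { field. lra. }
  rewrite Hss. replace (1 - z ^ 2 + z ^ 2) with 1 by ring. unfold Rdiv; ring.
Qed.

(** * Integration over the sphere *)

(** The parametrisation by height and longitude, with the height clamped to
    [-1,1]. Beyond the poles [sphere_pt] leaves the sphere, where an [S2_C1]
    function is uncontrolled; after clamping, compositions with such functions
    are continuous on the whole plane and have the same sphere integral. *)
Definition chart (p : R * R) : R3 := sphere_pt (clamp (-1) 1 (fst p)) (snd p).

Lemma chart_S2 p : S2 (chart p).
Proof. apply sphere_pt_S2, clamp_bounds; lra. Qed.

Lemma chart_sphere_pt z theta : -1 <= z <= 1 -> chart (z, theta) = sphere_pt z theta.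
Proof. intro Hz. unfold chart; cbn [fst snd]. now rewrite clamp_id. Qed.

Lemma continuous_chart p : continuous chart p.
Proof.
  set (c := fun q : R * R => clamp (-1) 1 (fst q)).
  assert (Hc : continuous c p).
  { apply (continuous_comp fst (clamp (-1) 1));
      [destruct p; apply continuous_fst | apply continuous_clamp]. }
  assert (Ht : continuous (snd : R * R -> R) p) by (destruct p; apply continuous_snd).
  assert (Hs : continuous (fun q => sqrt (1 - c q ^ 2)) p).
  { apply (continuous_comp (fun q => 1 - c q ^ 2) sqrt); [|apply continuous_sqrt].
    apply (continuous_minus (V := R_NormedModule)); [apply continuous_const|].
    apply (continuous_mult (K := R_AbsRing)); [exact Hc|].
    apply (continuous_mult (K := R_AbsRing)); [exact Hc | apply continuous_const]. }
  apply (continuous_pair (U := prod_UniformSpace R_UniformSpace R_UniformSpace)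
           (V := R_UniformSpace)); [|exact Hc].
  apply (continuous_pair (U := R_UniformSpace) (V := R_UniformSpace)).
  - apply (continuous_mult (K := R_AbsRing)); [exact Hs|].
    apply (continuous_comp snd cos); [exact Ht | apply continuous_cos].
  - apply (continuous_mult (K := R_AbsRing)); [exact Hs|].
    apply (continuous_comp snd sin); [exact Ht | apply continuous_sin].
Qed.

Lemma filterlim_chart {U : UniformSpace} (f : R3 -> U) p :
  filterlim f (within S2 (locally (chart p))) (locally (f (chart p))) ->
  continuous (fun q : R * R => f (chart q)) p.
Proof.
  intros Hf P HP.
  specialize (Hf P HP). unfold within, filtermap in Hf |- *.
  specialize (continuous_chart p _ Hf). unfold filtermap.
  apply filter_imp. intros q Hq. apply Hq, chart_S2.
Qed.

Lemma S2_C1_continuous_chart f G p : S2_C1 f G ->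
  continuous (fun q : R * R => f (chart q)) p.
Proof.
  intro HC. apply filterlim_chart, (S2_C1_continuous _ G); [exact HC | apply chart_S2].
Qed.

Lemma gradient_continuous_chart f G p : S2_C1 f G ->
  continuous (fun q : R * R => G (chart q)) p.
Proof.
  intro HC. apply filterlim_chart.
  now destruct (HC (chart p) (chart_S2 p)) as (_ & _ & H).
Qed.

Definition chart_continuous (F : R3 -> R) : Prop :=
  forall p, continuous (fun q : R * R => F (chart q)) p.

Lemma dot_gradients_chart_continuous f g F G : S2_C1 f F -> S2_C1 g G ->
  chart_continuous (fun x => dot (F x) (G x)).
Proof.
  intros Hf Hg p.
  apply (continuous_dot (fun q => F (chart q)) (fun q => G (chart q))).
  - now apply (gradient_continuous_chart f).
  - now apply (gradient_continuous_chart g).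
Qed.

Lemma chart_continuous_2d F z theta : chart_continuous F ->
  continuity_2d_pt (fun z theta => F (chart (z, theta))) z theta.
Proof.
  intro HF. apply continuity_2d_pt_filterlim.
  apply (filterlim_ext (fun q => F (chart q))); [now intros [a b] | apply (HF (z, theta))].
Qed.

Lemma chart_continuous_z F z theta : chart_continuous F ->
  continuous (fun z => F (chart (z, theta))) z.
Proof.
  intro HF. apply (continuous_comp (fun y : R => (y, theta)) (fun q => F (chart q)));
    [|apply HF].
  apply (continuous_pair (fun y : R => y) (fun _ => theta));
    [apply continuous_id | apply continuous_const].
Qed.

Lemma chart_continuous_slice F theta : chart_continuous F ->
  continuous (fun theta => RInt (fun z => F (chart (z, theta))) (-1) 1) theta.
Proof.
  intro HF. apply (continuous_RInt_param (fun z theta => F (chart (z, theta)))); [lra|].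
  intros; now apply chart_continuous_2d.
Qed.

Lemma S2_integral_chart (F : R3 -> R) :
  S2_integral F =
  RInt (fun theta => RInt (fun z => F (chart (z, theta))) (-1) 1) 0 (2 * PI).
Proof.
  apply RInt_ext; intros theta _. apply RInt_ext; intros z Hz.
  rewrite Rmin_left, Rmax_right in Hz by lra.
  rewrite chart_sphere_pt; [reflexivity | lra].
Qed.

Lemma S2_integral_minus F G : chart_continuous F -> chart_continuous G ->
  S2_integral (fun x => F x - G x) = S2_integral F - S2_integral G.
Proof.
  intros HF HG. rewrite !S2_integral_chart.
  rewrite <- (RInt_minus (V := R_CompleteNormedModule));
    try (apply (ex_RInt_continuous (V := R_CompleteNormedModule)); intros;
         now apply chart_continuous_slice).
  apply RInt_ext; intros theta _.
  rewrite <- (RInt_minus (V := R_CompleteNormedModule));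
    [reflexivity | |];
    apply (ex_RInt_continuous (V := R_CompleteNormedModule)); intros;
         now apply chart_continuous_z.
Qed.

(** The slice integrals are nonnegative and continuous in the longitude, so all
    of them vanish, and then so does the integrand on each meridian. The
    values on the interface circles can be compared along one of them. *)
Lemma S2_integral_eq_0 F : chart_continuous F -> (forall x, 0 <= F x) ->
  S2_integral F = 0 -> forall z, -1 <= z <= 1 -> F (sphere_pt z 0) = 0.
Proof.
  intros HF Hpos H0 z Hz. rewrite S2_integral_chart in H0.
  pose proof PI_RGT_0 as Hpi.
  assert (Hslice : RInt (fun z => F (chart (z, 0))) (-1) 1 = 0).
  { apply (RInt_eq_0_continuous
      (fun theta => RInt (fun z => F (chart (z, theta))) (-1) 1) 0 (2 * PI));
      [lra | | | exact H0 | lra].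
    - intro theta. now apply chart_continuous_slice.
    - intro theta. apply RInt_ge_0; auto; [lra|].
      apply (ex_RInt_continuous (V := R_CompleteNormedModule)); intros.
      now apply chart_continuous_z. }
  rewrite <- chart_sphere_pt by exact Hz.
  apply (RInt_eq_0_continuous (fun z => F (chart (z, 0))) (-1) 1);
    [lra | | | exact Hslice | exact Hz].
  - intro; now apply chart_continuous_z.
  - intro; apply Hpos.
Qed.

Lemma mass_zonal u l :
  (forall theta, is_RInt (fun y => u (sphere_pt y theta)) (-1) 1 l) -> mass u = l / 2.
Proof.
  intro Hu. unfold mass, S2_integral.
  rewrite (RInt_ext _ (fun _ => l)) by (intros; now apply is_RInt_unique).
  rewrite RInt_const. unfold scal; simpl. unfold mult; simpl.
  pose proof PI_RGT_0. field. lra.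
Qed.

(** * Uniqueness for the Poisson equation *)

(** The difference [w] of two solutions is an admissible test function for
    both equations. Subtracting them gives a zero Dirichlet integral, so [w] has
    zero gradient, and it is constant along the open meridian. *)
Lemma S2_poisson_unique v1 v2 f : S2_poisson v1 f -> S2_poisson v2 f ->
  forall z z', -1 < z < 1 -> -1 < z' < 1 ->
  v1 (sphere_pt z 0) - v2 (sphere_pt z 0) = v1 (sphere_pt z' 0) - v2 (sphere_pt z' 0).
Proof.
  intros (G1 & C1 & W1) (G2 & C2 & W2) z z' Hz Hz'.
  set (w := fun x => v1 x - v2 x).
  set (Gw := fun x => minus (G1 x) (G2 x)).
  assert (Cw : S2_C1 w Gw) by now apply S2_C1_minus.
  assert (H0 : S2_integral (fun x => dot (Gw x) (Gw x)) = 0).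
  { transitivity (S2_integral (fun x => dot (G1 x) (Gw x) - dot (G2 x) (Gw x))).
    { apply RInt_ext; intros; apply RInt_ext; intros. apply dot_minus_l. }
    rewrite S2_integral_minus, (W1 w Gw Cw), (W2 w Gw Cw); [ring | |];
      eapply dot_gradients_chart_continuous; eassumption. }
  assert (Hg : forall y, -1 <= y <= 1 -> snd (Gw (sphere_pt y 0)) = 0).
  { intros y Hy. apply dot_self_eq_0.
    apply (S2_integral_eq_0 (fun x => dot (Gw x) (Gw x))); trivial.
    - eapply dot_gradients_chart_continuous; eassumption.
    - intro x; unfold dot; nra. }
  assert (Hin : forall y, Rmin z z' <= y <= Rmax z z' -> -1 < y < 1).
  { intros y. unfold Rmin, Rmax. destruct Rle_dec; lra. }
  assert (Hd : forall y, -1 < y < 1 -> is_derive (fun y => w (sphere_pt y 0)) y 0).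
  { intros y Hy. generalize (is_derive_meridian w Gw y 0 Cw Hy).
    rewrite Hg by lra. unfold Rdiv. now rewrite Rmult_0_l. }
  destruct (MVT_gen (fun y => w (sphere_pt y 0)) z z' (fun _ => 0)) as (c & _ & E).
  - intros y Hy. apply Hd, Hin; lra.
  - intros y Hy. apply continuity_pt_filterlim.
    apply (ex_derive_continuous (V := R_NormedModule)).
    eexists; apply Hd, Hin, Hy.
  - fold (w (sphere_pt z 0)) (w (sphere_pt z' 0)). lra.
Qed.

(** * Equal curvatures force at most two interfaces *)

Lemma interfaces_lt n z i j : interfaces n z ->
  (i < j)%nat -> (j <= n + 1)%nat -> z i < z j.
Proof.
  intros (_ & _ & Hz) Hij. induction Hij as [|j Hij IH]; intro Hj.
  - specialize (Hz i ltac:(lia)). now replace (S i) with (i + 1)%nat by lia.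
  - specialize (Hz j ltac:(lia)). replace (S j) with (j + 1)%nat by lia.
    specialize (IH ltac:(lia)). lra.
Qed.

Lemma interfaces_interior n z k : interfaces n z -> (1 <= k <= n)%nat -> -1 < z k < 1.
Proof.
  intros Hi Hk. pose proof Hi as (H0 & H1 & _). split.
  - rewrite <- H0. apply (interfaces_lt n); [exact Hi | lia | lia].
  - rewrite <- H1. apply (interfaces_lt n); [exact Hi | lia | lia].
Qed.

(** The potentials for two values of gamma differ by a constant. With [d] and
    [w] the differences of curvature and potential between two interfaces, the
    equations read [d + 4 a w = 0] and [d + 4 b w = 0], so [d = 0]. *)
Lemma critical_interval_curvature n z u a b :
  axisymmetric_pattern n z u -> a < b ->
  critical_point a n z u -> critical_point b n z u ->
  forall k, (1 <= k <= n)%nat -> geodesic_curvature z k = geodesic_curvature z 1.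
Proof.
  intros (Hi & _) Hab (v1 & P1 & l1 & E1) (v2 & P2 & l2 & E2) k Hk.
  assert (Hz : forall j, (1 <= j <= n)%nat -> -1 < z j < 1)
    by (intros j; now apply interfaces_interior).
  pose proof (S2_poisson_unique v1 v2 _ P1 P2 (z k) (z 1%nat)
    (Hz k Hk) (Hz 1%nat ltac:(lia))) as Huniq.
  assert (HS : forall j, (1 <= j <= n)%nat -> S2 (sphere_pt (z j) 0)).
  { intros j Hj. apply sphere_pt_S2. specialize (Hz j Hj). lra. }
  pose proof (E1 k _ Hk (HS k Hk) eq_refl).
  pose proof (E2 k _ Hk (HS k Hk) eq_refl).
  pose proof (E1 1%nat _ ltac:(lia) (HS 1%nat ltac:(lia)) eq_refl).
  pose proof (E2 1%nat _ ltac:(lia) (HS 1%nat ltac:(lia)) eq_refl).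
  set (d := geodesic_curvature z k - geodesic_curvature z 1).
  set (w := v1 (sphere_pt (z k) 0) - v1 (sphere_pt (z 1%nat) 0)).
  assert (F1 : d + 4 * a * w = 0) by (unfold d, w; lra).
  assert (F2 : d + 4 * b * w = 0).
  { unfold d. replace w with (v2 (sphere_pt (z k) 0) - v2 (sphere_pt (z 1%nat) 0))
      by (unfold w; lra). lra. }
  assert (w = 0) by (apply (Rmult_eq_reg_l (b - a)); lra).
  unfold d in F1; nra.
Qed.

(** This is the map from sine to tangent; its inverse is [t / sqrt (1 + t^2)]. *)
Lemma div_sqrt_inj s t : -1 < s < 1 -> -1 < t < 1 ->
  s / sqrt (1 - s ^ 2) = t / sqrt (1 - t ^ 2) -> s = t.
Proof.
  intros Hs Ht E.
  assert (Hinv : forall r, -1 < r < 1 -> 0 < sqrt (1 - r ^ 2) /\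
    r = r / sqrt (1 - r ^ 2) / sqrt (1 + (r / sqrt (1 - r ^ 2)) ^ 2)).
  { intros r Hr.
    assert (P : 0 < sqrt (1 - r ^ 2)) by (apply sqrt_lt_R0; nra). split; [exact P|].
    assert (Q : sqrt (1 - r ^ 2) * sqrt (1 - r ^ 2) = 1 - r ^ 2) by (apply sqrt_sqrt; nra).
    replace (1 + (r / sqrt (1 - r ^ 2)) ^ 2) with ((/ sqrt (1 - r ^ 2)) ^ 2).
    - rewrite sqrt_pow2 by (apply Rlt_le, Rinv_0_lt_compat, P). field. lra.
    - transitivity ((sqrt (1 - r ^ 2) * sqrt (1 - r ^ 2) + r ^ 2) * (/ sqrt (1 - r ^ 2)) ^ 2).
      + rewrite Q. ring.
      + field. lra. }
  rewrite (proj2 (Hinv s Hs)), (proj2 (Hinv t Ht)), E. reflexivity.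
Qed.

(** The sign in the curvature alternates, so equal curvatures give
    [z_k = (-1)^(k+1) z_1]. A third interface would then coincide with the
    first. *)
Lemma equal_curvature_cap_or_band n z : (1 <= n)%nat -> interfaces n z ->
  (forall k, (1 <= k <= n)%nat -> geodesic_curvature z k = geodesic_curvature z 1) ->
  n = 1%nat \/ (n = 2%nat /\ z 1%nat = - z 2%nat).
Proof.
  intros Hn Hi Hk. unfold geodesic_curvature in Hk.
  destruct (Nat.eq_dec n 1) as [|Hn1]; [now left | right].
  assert (E3 : ~ (3 <= n)%nat).
  { intro H3. specialize (Hk 3%nat ltac:(lia)).
    assert (z 1%nat < z 3%nat) by (apply (interfaces_lt n); [exact Hi | lia | lia]).
    assert (z 3%nat = z 1%nat); [|lra].
    apply div_sqrt_inj; try (apply (interfaces_interior n); [exact Hi | lia]).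
    simpl in Hk |- *. unfold Rdiv in *. lra. }
  split; [lia|].
  specialize (Hk 2%nat ltac:(lia)).
  pose proof (interfaces_interior n z 2 Hi ltac:(lia)).
  apply div_sqrt_inj; [apply (interfaces_interior n); [exact Hi | lia] | lra |].
  replace ((- z 2%nat) ^ 2) with (z 2%nat ^ 2) by ring.
  simpl in Hk |- *. unfold Rdiv in *. lra.
Qed.

(** * Zonal solutions of the Poisson equation *)

Definition potential (h : R -> R) (x : R3) : R := RInt h 0 (height x).

Definition potential_gradient (h : R -> R) (x : R3) : R3 :=
  scal (h (height x)) (minus (pt 0 0 1) (scal (height x) x)).

Lemma dot_potential_gradient h x y :
  dot (potential_gradient h x) y = h (height x) * (snd y - height x * dot y x).
Proof.
  destruct x as [[x1 x2] x3], y as [[y1 y2] y3].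
  unfold potential_gradient, dot, height, minus, plus, opp, scal, pt; simpl.
  unfold plus, opp, scal, mult; simpl. unfold mult; simpl. ring.
Qed.

(** The ambient differential of [potential h] is not tangent to the sphere.
    Subtracting [c |y|^2 - c], which is zero on the sphere, removes its normal
    part for [c = h(z) z / 2]. *)
Lemma filterdiff_potential h (x : R3) : (forall y, continuous h y) -> S2 x ->
  @filterdiff R_AbsRing R3 R_NormedModule (potential h) (within S2 (locally x))
    (fun y => dot (potential_gradient h x) y).
Proof.
  intros Hh Hx.
  set (c := h (height x) * height x / 2).
  assert (D1 : @filterdiff R_AbsRing R3 R_NormedModule (potential h) (locally x)
                 (fun y => snd y * h (height x))).
  { apply (filterdiff_comp' (K := R_AbsRing) (U := R3) (V := R_NormedModule)
      (W := R_NormedModule) height (RInt h 0) x height (fun y => y * h (height x))).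
    - apply filterdiff_linear, is_linear_snd.
    - now apply is_derive_RInt_continuous. }
  assert (D2 : @filterdiff R_AbsRing R3 R_NormedModule
                 (fun y => potential h y - (c * dot y y - c)) (locally x)
                 (fun y => dot (potential_gradient h x) y)).
  { refine (filterdiff_ext_lin (K := R_AbsRing) (U := R3) (V := R_NormedModule) _ _ _
     (filterdiff_minus_fct (K := R_AbsRing) (U := R3) (V := R_NormedModule) _ _ _ _ D1
      (filterdiff_minus_fct (K := R_AbsRing) (U := R3) (V := R_NormedModule) _ _ _ _
      (filterdiff_scal_r_fct (K := R_AbsRing) (U := R3) (V := R_NormedModule) c _ _
        Rmult_comm (filterdiff_dot_self x))
      (filterdiff_const (K := R_AbsRing) (U := R3) (V := R_NormedModule) c))) _).
    intro y. rewrite dot_potential_gradient.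
    unfold minus, plus, opp, scal, zero; simpl. unfold mult; simpl. unfold c. field. }
  assert (Hlim : is_filter_lim (within S2 (locally x)) x).
  { intros P HP. unfold within. apply (filter_imp P); [auto | exact HP]. }
  pose proof (within_S2_proper x Hx) as PF.
  assert (Heq : forall y, S2 y -> potential h y - (c * dot y y - c) = potential h y).
  { intros y Hy. unfold S2 in Hy. rewrite Hy. ring. }
  apply (filterdiff_ext_loc (K := R_AbsRing) (U := R3) (V := R_NormedModule)
           (fun y => potential h y - (c * dot y y - c))).
  - unfold within. now apply filter_forall.
  - intros y Hy.
    assert (y = x) as ->
      by exact (is_filter_lim_unique (K := R_AbsRing) (V := R3) y x Hy Hlim).
    now apply Heq.
  - apply (filterdiff_filter_le _ _ _ (locally x) x PF); trivial.
    intros P HP. exact HP.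
Qed.

Lemma S2_C1_potential h : (forall y, continuous h y) ->
  S2_C1 (potential h) (potential_gradient h).
Proof.
  intros Hh x Hx. split; [|split].
  - rewrite dot_potential_gradient. unfold S2 in Hx; rewrite Hx.
    unfold height; ring.
  - now apply filterdiff_potential.
  - assert (C : continuous (potential_gradient h) x).
    { assert (Ch : continuous height x) by (destruct x; apply continuous_snd).
      apply (continuous_scal (V := R3)).
      - apply (continuous_comp height h); [exact Ch | apply Hh].
      - apply (continuous_minus (V := R3)); [apply continuous_const|].
        apply (continuous_scal (V := R3)); [exact Ch | apply continuous_id]. }
    intros P HP. unfold filtermap, within.
    apply (filter_imp (fun y => P (potential_gradient h y))); [auto | exact (C P HP)].
Qed.

(** Since [p z + q = - (1 - z^2) h z], the product rule shows that the integrand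
    is the derivative of [(p z + q) Phi z]. At the poles [Phi] may fail to be
    differentiable, so the difference of this product and the primitive of the
    integrand is shown to be constant by the mean value theorem, which needs
    derivatives in the open interval only. *)
Lemma is_RInt_flux_step (f h Phi Psi : R -> R) (p q a b : R) :
  -1 <= a -> a < b -> b <= 1 ->
  (forall z, continuous h z) -> (forall z, continuous Phi z) ->
  (forall z, continuous Psi z) ->
  (forall z, -1 < z < 1 -> is_derive Phi z (Psi z / (1 - z ^ 2))) ->
  (forall z, a < z < b -> f z = p) ->
  (forall z, a < z < b -> (1 - z ^ 2) * h z = - (p * z + q)) ->
  is_RInt (fun z => f z * Phi z - h z * Psi z) a b
    ((p * b + q) * Phi b - (p * a + q) * Phi a).
Proof.
  intros Ha Hab Hb Ch CPhi CPsi Hd Hf Hh.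
  apply is_RInt_ext with (fun z => p * Phi z - h z * Psi z).
  { rewrite Rmin_left, Rmax_right by lra. intros z Hz. now rewrite Hf. }
  set (g := fun z => p * Phi z - h z * Psi z).
  assert (Cg : forall z, continuous g z).
  { intro z. apply (continuous_minus (V := R_NormedModule)).
    - apply (continuous_mult (K := R_AbsRing)); [apply continuous_const | apply CPhi].
    - apply (continuous_mult (K := R_AbsRing)); [apply Ch | apply CPsi]. }
  assert (Hex : forall c d, is_RInt g c d (RInt g c d)).
  { intros c d. now apply is_RInt_continuous. }
  assert (HP : forall y, is_derive (fun y => RInt g a y) y (g y))
    by (intro y; now apply is_derive_RInt_continuous).
  destruct (MVT_gen (fun z => (p * z + q) * Phi z - RInt g a z) a b (fun _ => 0))
    as (c & _ & E).
  - rewrite Rmin_left, Rmax_right by lra. intros z Hz.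
    assert (Hd' : is_derive (fun z => p * z + q) z p) by (auto_derive; [trivial | ring]).
    generalize (is_derive_minus (K := R_AbsRing) (V := R_NormedModule) _ _ z _ _
      (is_derive_mult (K := R_AbsRing) _ _ z _ _ Hd' (Hd z ltac:(lra)) Rmult_comm) (HP z)).
    match goal with |- is_derive _ _ ?l -> _ => replace l with 0; [trivial|] end.
    unfold minus, plus, opp, mult; simpl. unfold g.
    specialize (Hh z Hz).
    replace (p * z + q) with (- ((1 - z ^ 2) * h z)) by lra.
    field. nra.
  - intros z _. apply continuity_pt_filterlim.
    apply (continuous_minus (V := R_NormedModule) (fun y => (p * y + q) * Phi y)
             (fun y => RInt g a y)).
    + apply (continuous_mult (K := R_AbsRing)); [|apply CPhi].
      apply (ex_derive_continuous (V := R_NormedModule)). auto_derive. trivial.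
    + apply (ex_derive_continuous (V := R_NormedModule) (fun y => RInt g a y)).
      eexists; apply HP.
  - assert (RInt g a a = 0) by apply (RInt_point (V := R_CompleteNormedModule)).
    replace ((p * b + q) * Phi b - (p * a + q) * Phi a) with (RInt g a b) by lra.
    apply Hex.
Qed.

(** Green's formula for a zonal potential holds on each meridian separately, so
    the weak equation is reduced to integrals in [z]. Here [Phi] is the test
    function along a meridian and [Psi] the third component of its gradient. *)
Lemma S2_poisson_potential h f : (forall z, continuous h z) ->
  (forall theta Phi Psi, (forall z, continuous Phi z) -> (forall z, continuous Psi z) ->
     (forall z, -1 < z < 1 -> is_derive Phi z (Psi z / (1 - z ^ 2))) ->
     is_RInt (fun z => f (sphere_pt z theta) * Phi z - h z * Psi z) (-1) 1 0) ->
  S2_poisson (potential h) f.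
Proof.
  intros Ch Hf. exists (potential_gradient h). split; [now apply S2_C1_potential|].
  intros phi G HC. apply RInt_ext; intros theta _.
  set (Phi := fun z => phi (chart (z, theta))).
  set (Psi := fun z => dot (G (chart (z, theta))) (pt 0 0 1)).
  assert (CPhi : forall z, continuous Phi z).
  { intro z. apply chart_continuous_z.
    intro p. now apply (S2_C1_continuous_chart phi G). }
  assert (CPsi : forall z, continuous Psi z).
  { intro z. apply (chart_continuous_z (fun x => dot (G x) (pt 0 0 1))).
    intro p. apply (continuous_dot (fun q => G (chart q)) (fun _ => pt 0 0 1));
      [now apply (gradient_continuous_chart phi) | apply continuous_const]. }
  assert (EPsi : forall z, -1 <= z <= 1 -> Psi z = snd (G (sphere_pt z theta))).
  { intros z Hz. unfold Psi. rewrite chart_sphere_pt by exact Hz.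
    unfold dot, pt; simpl. ring. }
  assert (Hd : forall z, -1 < z < 1 -> is_derive Phi z (Psi z / (1 - z ^ 2))).
  { intros z Hz. rewrite EPsi by lra.
    apply (is_derive_ext_loc (fun y => phi (sphere_pt y theta)));
      [|now apply is_derive_meridian].
    generalize (locally_open_interval _ _ _ Hz). apply filter_imp.
    intros y Hy. unfold Phi.
    now rewrite chart_sphere_pt by lra. }
  assert (I : is_RInt (fun z => h z * Psi z) (-1) 1 (RInt (fun z => h z * Psi z) (-1) 1)).
  { apply is_RInt_continuous. intro z.
    apply (continuous_mult (K := R_AbsRing)); [apply Ch | apply CPsi]. }
  transitivity (RInt (fun z => h z * Psi z) (-1) 1).
  - apply RInt_ext. intros z Hz. rewrite Rmin_left, Rmax_right in Hz by lra.
    rewrite dot_potential_gradient.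
    destruct (HC (sphere_pt z theta)) as (T & _); [apply sphere_pt_S2; lra|].
    rewrite T, EPsi by lra. unfold height, sphere_pt, pt; cbn [snd].
    match goal with |- ?a = ?b => change (@eq R a b) end. ring.
  - symmetry. apply is_RInt_unique.
    pose proof (is_RInt_plus (V := R_NormedModule) _ _ _ _ _ _
      (Hf theta Phi Psi CPhi CPsi Hd) I) as J.
    unfold plus in J; simpl in J. rewrite Rplus_0_l in J. revert J. apply is_RInt_ext.
    rewrite Rmin_left, Rmax_right by lra. intros z Hz.
    unfold Phi. rewrite chart_sphere_pt by lra.
    match goal with |- ?a = ?b => change (@eq R a b) end. ring.
Qed.

(** * The potentials of the single and the double cap *)

Lemma pattern_sphere_pt n z u k y theta : axisymmetric_pattern n z u -> (k <= n)%nat ->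
  -1 <= y <= 1 -> z k <= y < z (k + 1)%nat -> u (sphere_pt y theta) = (-1) ^ (k + 1).
Proof.
  intros (_ & Hu) Hk Hy Hy'. apply Hu; [exact Hk | now apply sphere_pt_S2 | exact Hy'].
Qed.

(** The derivative [V'] of the zonal solution of
    [- ((1 - z^2) V')' = u - m] for a single interface at [a]: it is
    [(1 - a) / (1 - z)] below [a] and [(1 + a) / (1 + z)] above. In each region
    one of the two factors is 1. *)
Definition cap_field (a z : R) : R :=
  (1 - a) / (1 - Rmin a z) * ((1 + a) / (1 + Rmax a z)).

(** The same derivative for interfaces at [- a] and [a]: it is
    [- 2 (1 - a) z / (1 - z^2)] between them, [2 a / (1 - z)] below and
    [- 2 a / (1 + z)] above. Again the factors that do not belong to a region
    are constant there. *)
Definition band_field (a z : R) : R :=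
  - (2 * (1 - a) * clamp (- a) a z / (1 - clamp (- a) a z ^ 2))
  * ((1 + a) / (1 - Rmin (- a) z)) * ((1 + a) / (1 + Rmax a z)).

Lemma continuous_north_factor c a z : a < 1 -> continuous (fun y => c / (1 - Rmin a y)) z.
Proof.
  intro Ha. apply continuous_Rdiv; [apply continuous_const | |].
  - apply (continuous_minus (V := R_NormedModule));
      [apply continuous_const | apply continuous_Rmin_l].
  - pose proof (Rmin_l a z). lra.
Qed.

Lemma continuous_south_factor c a z : -1 < a -> continuous (fun y => c / (1 + Rmax a y)) z.
Proof.
  intro Ha. apply continuous_Rdiv; [apply continuous_const | |].
  - apply (continuous_plus (V := R_NormedModule));
      [apply continuous_const | apply continuous_Rmax_l].
  - pose proof (Rmax_l a z). lra.
Qed.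

Lemma continuous_cap_field a z : -1 < a < 1 -> continuous (cap_field a) z.
Proof.
  intro Ha. apply (continuous_mult (K := R_AbsRing));
    [now apply continuous_north_factor | now apply continuous_south_factor].
Qed.

Lemma continuous_band_field a z : 0 < a < 1 -> continuous (band_field a) z.
Proof.
  intro Ha. pose proof (clamp_bounds (- a) a z ltac:(lra)).
  pose proof (continuous_clamp (- a) a z) as Hc.
  apply (continuous_mult (K := R_AbsRing)); [|apply continuous_south_factor; lra].
  apply (continuous_mult (K := R_AbsRing)); [|apply continuous_north_factor; lra].
  apply (continuous_opp (V := R_NormedModule)), continuous_Rdiv; [| |nra].
  - apply (continuous_mult (K := R_AbsRing)); [apply continuous_const | exact Hc].
  - apply (continuous_minus (V := R_NormedModule)); [apply continuous_const|].
    apply (continuous_mult (K := R_AbsRing)); [exact Hc|].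
    apply (continuous_mult (K := R_AbsRing)); [exact Hc | apply continuous_const].
Qed.

Lemma band_field_odd a z : 0 < a -> band_field a (- z) = - band_field a z.
Proof.
  intro Ha. unfold band_field.
  assert (clamp (- a) a (- z) = - clamp (- a) a z) as ->.
  { unfold clamp, Rmin, Rmax. repeat destruct Rle_dec; lra. }
  replace (Rmin (- a) (- z)) with (- Rmax a z)
    by (unfold Rmin, Rmax; repeat destruct Rle_dec; lra).
  replace (Rmax a (- z)) with (- Rmin (- a) z)
    by (unfold Rmin, Rmax; repeat destruct Rle_dec; lra).
  replace ((- clamp (- a) a z) ^ 2) with (clamp (- a) a z ^ 2) by ring.
  unfold Rminus; rewrite !Ropp_involutive. unfold Rdiv; ring.
Qed.

(** The mass is [- a], so [u - m] is [a - 1] below the interface and [1 + a]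
    above; its primitives [(a - 1)(z + 1)] and [(1 + a)(z - 1)] agree at [a] and
    vanish at the poles, so all boundary terms cancel. *)
Lemma single_cap_poisson z u : axisymmetric_pattern 1 z u ->
  S2_poisson (potential (cap_field (z 1%nat))) (fun x => u x - mass u).
Proof.
  intro Hp. pose proof Hp as (Hi & _).
  pose proof (interfaces_interior 1 z 1 Hi ltac:(lia)) as Ha.
  pose proof Hi as (Z0 & Z2 & _); simpl in Z2.
  set (a := z 1%nat) in *.
  assert (Hu1 : forall y theta, -1 < y < a -> u (sphere_pt y theta) = -1).
  { intros y theta Hy. rewrite (pattern_sphere_pt 1 z u 0 y theta Hp);
       [simpl; ring | lia | lra |].
    simpl. fold a. lra. }
  assert (Hu2 : forall y theta, a < y < 1 -> u (sphere_pt y theta) = 1).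
  { intros y theta Hy. rewrite (pattern_sphere_pt 1 z u 1 y theta Hp);
       [simpl; ring | lia | lra |].
    simpl. fold a. lra. }
  assert (Hm : mass u = - a).
  { rewrite (mass_zonal u (- 2 * a)); [field|]. intro theta.
    replace (-2 * a) with (plus ((a - -1) * -1) ((1 - a) * 1)) by (unfold plus; simpl; ring).
    apply (is_RInt_Chasles (V := R_NormedModule)) with a; apply is_RInt_step; auto; lra. }
  apply S2_poisson_potential; [intro; now apply continuous_cap_field|].
  intros theta Phi Psi CPhi CPsi Hd.
  assert (Ch : forall y, continuous (cap_field a) y) by (intro; now apply continuous_cap_field).
  pose proof (is_RInt_flux_step (fun y => u (sphere_pt y theta) - mass u) (cap_field a) Phi Psi
    (a - 1) (a - 1) (-1) a ltac:(lra) ltac:(lra) ltac:(lra) Ch CPhi CPsi Hd) as I1.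
  pose proof (is_RInt_flux_step (fun y => u (sphere_pt y theta) - mass u) (cap_field a) Phi Psi
    (1 + a) (- (1 + a)) a 1 ltac:(lra) ltac:(lra) ltac:(lra) Ch CPhi CPsi Hd) as I2.
  match type of I1 with _ -> _ -> is_RInt _ _ _ ?v1 =>
  match type of I2 with _ -> _ -> is_RInt _ _ _ ?v2 =>
    replace 0 with (plus v1 v2) by (unfold plus; simpl; ring) end end.
  apply (is_RInt_Chasles (V := R_NormedModule)) with a.
  - apply I1; intros y Hy.
    + rewrite Hu1, Hm by lra. ring.
    + unfold cap_field. rewrite Rmin_right, Rmax_left by lra. field. lra.
  - apply I2; intros y Hy.
    + rewrite Hu2, Hm by lra. ring.
    + unfold cap_field. rewrite Rmin_left, Rmax_right by lra. field. lra.
Qed.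

(** The mass is [2 a - 1], and [u - m] takes the values [- 2 a], [2 - 2 a],
    [- 2 a], with primitives [- 2 a (z + 1)], [(2 - 2 a) z], [- 2 a (z - 1)] that
    agree at [- a] and [a] and vanish at the poles. *)
Lemma double_cap_poisson z u : axisymmetric_pattern 2 z u -> z 1%nat = - z 2%nat ->
  S2_poisson (potential (band_field (z 2%nat))) (fun x => u x - mass u).
Proof.
  intros Hp Hsym. pose proof Hp as (Hi & _).
  pose proof (interfaces_interior 2 z 2 Hi ltac:(lia)) as Ha.
  pose proof (interfaces_lt 2 z 1 2 Hi ltac:(lia) ltac:(lia)) as Hlt.
  pose proof Hi as (Z0 & Z3 & _); simpl in Z3.
  set (a := z 2%nat) in *.
  assert (Ha0 : 0 < a < 1) by lra.
  assert (Hu1 : forall y theta, -1 < y < - a -> u (sphere_pt y theta) = -1).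
  { intros y theta Hy. rewrite (pattern_sphere_pt 2 z u 0 y theta Hp);
       [simpl; ring | lia | lra |].
    simpl. lra. }
  assert (Hu2 : forall y theta, - a < y < a -> u (sphere_pt y theta) = 1).
  { intros y theta Hy. rewrite (pattern_sphere_pt 2 z u 1 y theta Hp);
       [simpl; ring | lia | lra |].
    simpl. fold a. lra. }
  assert (Hu3 : forall y theta, a < y < 1 -> u (sphere_pt y theta) = -1).
  { intros y theta Hy. rewrite (pattern_sphere_pt 2 z u 2 y theta Hp);
       [simpl; ring | lia | lra |].
    simpl. fold a. lra. }
  assert (Hm : mass u = 2 * a - 1).
  { rewrite (mass_zonal u (4 * a - 2)); [field|]. intro theta.
    replace (4 * a - 2) with (plus (plus ((- a - -1) * -1) ((a - - a) * 1)) ((1 - a) * -1))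
      by (unfold plus; simpl; ring).
    apply (is_RInt_Chasles (V := R_NormedModule)) with a.
    - apply (is_RInt_Chasles (V := R_NormedModule)) with (- a); apply is_RInt_step; auto; lra.
    - apply is_RInt_step; auto; lra. }
  assert (Ch : forall y, continuous (band_field a) y) by (intro; now apply continuous_band_field).
  apply S2_poisson_potential; [exact Ch|].
  intros theta Phi Psi CPhi CPsi Hd.
  pose proof (is_RInt_flux_step (fun y => u (sphere_pt y theta) - mass u) (band_field a) Phi Psi
    (- 2 * a) (- 2 * a) (-1) (- a) ltac:(lra) ltac:(lra) ltac:(lra) Ch CPhi CPsi Hd) as I1.
  pose proof (is_RInt_flux_step (fun y => u (sphere_pt y theta) - mass u) (band_field a) Phi Psi
    (2 - 2 * a) 0 (- a) a ltac:(lra) ltac:(lra) ltac:(lra) Ch CPhi CPsi Hd) as I2.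
  pose proof (is_RInt_flux_step (fun y => u (sphere_pt y theta) - mass u) (band_field a) Phi Psi
    (- 2 * a) (2 * a) a 1 ltac:(lra) ltac:(lra) ltac:(lra) Ch CPhi CPsi Hd) as I3.
  match type of I1 with _ -> _ -> is_RInt _ _ _ ?v1 =>
  match type of I2 with _ -> _ -> is_RInt _ _ _ ?v2 =>
  match type of I3 with _ -> _ -> is_RInt _ _ _ ?v3 =>
    replace 0 with (plus (plus v1 v2) v3) by (unfold plus; simpl; ring) end end end.
  apply (is_RInt_Chasles (V := R_NormedModule)) with a;
    [apply (is_RInt_Chasles (V := R_NormedModule)) with (- a)|].
  - apply I1; intros y Hy.
    + rewrite Hu1, Hm by lra. ring.
    + unfold band_field, clamp.
      rewrite (Rmin_right a), (Rmax_left (- a)), (Rmin_right (- a)), (Rmax_left a) by lra.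
      field. split; [|nra]. lra.
  - apply I2; intros y Hy.
    + rewrite Hu2, Hm by lra. ring.
    + unfold band_field. rewrite clamp_id, Rmin_left, Rmax_left by lra.
      field. repeat split; nra.
  - apply I3; intros y Hy.
    + rewrite Hu3, Hm by lra. ring.
    + unfold band_field, clamp.
      rewrite (Rmin_left a), (Rmax_right (- a)), (Rmin_left (- a)), (Rmax_right a) by lra.
      field. split; [lra|nra].
Qed.

Theorem proposition5p2 :
  forall (n : nat) (z : nat -> R) (u : R3 -> R),
    (1 <= n)%nat ->
    axisymmetric_pattern n z u ->
    -1 < mass u < 1 ->
    ((exists I : R -> Prop,
        nondegenerate_interval I /\
        (forall gamma : R, I gamma -> 0 < gamma) /\
        (forall gamma : R, I gamma -> critical_point gamma n z u))
     <->
     (n = 1%nat \/ (n = 2%nat /\ z 1%nat = - z 2%nat))).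
Proof.
  intros n z u Hn Hp _. split.
  - intros (I & (_ & a & b & Ia & Ib & Hab) & Hpos & Hcrit).
    apply equal_curvature_cap_or_band; [exact Hn | apply Hp |].
    apply (critical_interval_curvature n z u a b); auto.
  - intro Hcase. exists (fun gamma => 0 < gamma). split; [|split; [auto|]].
    { split; [intros; lra | exists 1, 2; lra]. }
    intros gamma _. destruct Hcase as [-> | [-> Hsym]].
    + eexists; split; [exact (single_cap_poisson z u Hp)|].
      exists (geodesic_curvature z 1
              + 4 * gamma * RInt (cap_field (z 1%nat)) 0 (z 1%nat)).
      intros k x Hk _ Hx. unfold potential.
      replace k with 1%nat in * by lia. now rewrite Hx.
    + eexists; split; [exact (double_cap_poisson z u Hp Hsym)|].
      pose proof (interfaces_interior 2 z 2 (proj1 Hp) ltac:(lia)) as Ha.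
      pose proof (interfaces_lt 2 z 1 2 (proj1 Hp) ltac:(lia) ltac:(lia)) as Hlt.
      exists (geodesic_curvature z 2
              + 4 * gamma * RInt (band_field (z 2%nat)) 0 (z 2%nat)).
      intros k x Hk _ Hx. unfold potential. rewrite Hx.
      destruct (Nat.eq_dec k 2) as [-> | Hk2]; [reflexivity|].
      replace k with 1%nat in * by lia. rewrite Hsym.
      rewrite RInt_odd.
      * unfold geodesic_curvature. rewrite Hsym.
        replace ((- z 2%nat) ^ 2) with (z 2%nat ^ 2) by ring.
        simpl. unfold Rdiv. ring.
      * intro. apply continuous_band_field. lra.
      * intro. apply band_field_odd. lra.
Qed.
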